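(* The map $\mathcal{P}:\mathbf{SDS}\to\mathbf{OBD}$ is a contravariant functor.
   Context: **Bratteli diagrams.** A Bratteli diagram $(V,E)$ consists of a vertex set $V=V_0\sqcup V_1\sqcup\cdots$ with each $V_n$ finite and non-empty and $V_0$ a singleton, and an edge set $E=E_1\sqcup E_2\sqcup\cdots$ with each $E_n$ finite and non-empty, together with maps $r,s:E\to V$ (range, source) such that $r(E_n)\subseteq V_n$, $s(E_n)\subseteq V_{n-1}$, $s^{-1}\{v\}\neq\varnothing$ for all $v\in V$ and $r^{-1}\{v\}\ne\varnothing$ for all $v\in V\setminus V_0$. An ordered Bratteli diagram $(V,E,\geq)$ is a Bratteli diagram with a partial order on $E$ such that $e,e'$ are comparable iff $r(e)=r(e')$. **Edge sets.** An ordered edge set from a finite set $S$ to a finite set $T$ is a finite set $F$ with maps $s:F\to S$, $r:F\to T$ and a linear order on each $r^{-1}\{w\}$, $w\in T$. If $G$ is an ordered edge set from $T$ to $U$, then $F\circ G=\{(e,g)\in F\times G: r(e)=s(g)\}$, with source $s(e)$, range $r(g)$, and order: for $r(g)=r(g')$, $(e,g)<(e',g')$ iff $g<g'$, or $g=g'$ and $e<e'$. Write $F\cong F'$ if there is a bijection $F\to F'$ preserving sources, ranges and order. For $k<l$, $E_{k,l}=E_{k+1}\circ\cdots\circ E_l$; $E_{k,k}$ consists of one edge from $v$ to $v$ for each $v\in V_k$. **The category $\mathbf{OBD}$.** Objects: ordered Bratteli diagrams. An ordered premorphism $f:B=(V,E,\ge)\to C=(W,S,\ge)$ is a triple $(F,(f_n)_{n\ge0},\geq)$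 where $(f_n)$ is an unbounded sequence of integers with $0=f_0\le f_1\le\cdots$, and $F=F_0\sqcup F_1\sqcup\cdots$ where each $F_n$ is a non-empty finite ordered edge set from $V_n$ to $W_{f_n}$ such that every $v\in V_n$ is the source of some edge of $F_n$ (that is, $s^{-1}\{v\}\neq\varnothing$ for all $v\in V$) and every $w\in W_{f_n}$ is the range of some edge of $F_n$, $F_0$ is a singleton, and $E_{n+1}\circ F_{n+1}\cong F_n\circ S_{f_n,f_{n+1}}$ for all $n\ge0$. The composition of $f:B\to C$ and $g=(G,(g_n),\ge):C\to D$ is $gf=(H,(h_n),\ge)$ with $h_n=g_{f_n}$, $H_n=F_n\circ G_{f_n}$. Premorphisms $f,g:B\to C$ are equivalent if there are positive integers $n_1<m_1<n_2<m_2<\cdots$ with $f_{n_k}<g_{m_k}<f_{n_{k+1}}$ and, for all $k\ge1$, $E_{n_k,m_k}\circ G_{m_k}\cong F_{n_k}\circ S_{f_{n_k},g_{m_k}}$ and $E_{m_k,n_{k+1}}\circ F_{n_{k+1}}\cong G_{m_k}\circ S_{g_{m_k},f_{n_{k+1}}}$. Morphisms in $\mathbf{OBD}$ are equivalence classes $[f]$, with $[g][f]=[gf]$. **The category $\mathbf{SDS}$.** An essentially minimal totally disconnected dynamical system $(X,\varphi,x_0)$ consists of a metrizable compact totally disconnected space $X$, a homeomorphism $\varphi$ of $X$ such that $(X,\varphi)$ has a unique minimal (non-empty closed invariant) subset, and a point $x_0$ of that subset. A Kakutani–Rokhlin partition for it is a finite partition $P=\{Z(k,j): 1\le k\le K,\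 1\le j\le J(k)\}$ of $X$ into non-empty clopen sets with $\varphi(Z(k,j))=Z(k,j+1)$ for $1\le j<J(k)$, and such that the top $Z=\bigcup_kZ(k,J(k))$ contains $x_0$ and $\varphi(Z)=\bigcup_kZ(k,1)$; the sequences $(Z(k,1),\ldots,Z(k,J(k)))$ are its towers. A system of Kakutani–Rokhlin partitions is a sequence $\mathcal{R}=(P_n)_{n\ge0}$ of such partitions with $P_0=\{X\}$, $P_{n+1}$ refining $P_n$ (written $P_n\le P_{n+1}$), the tops $Z_n$ of $P_n$ ($n\ge1$) decreasing with intersection $\{x_0\}$, and $\bigcup_nP_n$ a basis for the topology of $X$. Objects of $\mathbf{SDS}$ are quadruples $(X,\varphi,x_0,\mathcal{R})$; morphisms $(X,\varphi,x_0,\mathcal{R})\to(Y,\psi,y_0,\mathcal{S})$ are continuous maps $\alpha:X\to Y$ with $\alpha\circ\varphi=\psi\circ\alpha$ and $\alpha(x_0)=y_0$. **The edge set $E(P,Q)$.** If $P\le Q$ are Kakutani–Rokhlin partitions and the top of $P$ contains the top of $Q$, $E(P,Q)$ is the set of triples $(S,T,k)$ with $S=(Z_1,\ldots,Z_n)$ a tower of $P$, $T=(Y_1,\ldots,Y_m)$ a tower of $Q$, $k\ge0$ an integer with $Y_{k+j}\subseteq Z_j$ for $1\le j\le n$; source $S$, range $T$, and $(S,T,k)\le(S',T',k')$ iff $T=T'$ and $k\le k'$. **The map $\mathcal{P}$.** On objects with $\mathcal{R}=(P_n)$: $\mathcal{P}(X,\varphi,x_0,\mathcal{R})$ is the ordered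 Bratteli diagram with $V_n=\{(n,T): T\text{ a tower of }P_n\}$ and $E_n$ the copy $\{(n,S,T,k):(S,T,k)\in E(P_{n-1},P_n)\}$ of $E(P_{n-1},P_n)$ with its order. For a morphism $\alpha:(X,\varphi,x_0,(P_n))\to(Y,\psi,y_0,(Q_n))$, let $\alpha^{-1}(Q_n)$ be the set of inverse images of elements of $Q_n$, a Kakutani–Rokhlin partition for $(X,\varphi,x_0)$; for a tower $S=(Z_1,\ldots,Z_m)$ of $Q_n$ write $\alpha^{-1}(S)=(\alpha^{-1}(Z_1),\ldots,\alpha^{-1}(Z_m))$. Choose integers $0=f_0\le f_1\le\cdots$, unbounded, with $\alpha^{-1}(Q_n)\le P_{f_n}$ and the top of $\alpha^{-1}(Q_n)$ containing the top of $P_{f_n}$; let $F_n=\{(n,S,T,k):(\alpha^{-1}(S),T,k)\in E(\alpha^{-1}(Q_n),P_{f_n})\}$ with source $(n,S)$, range $(f_n,T)$ and the induced order ($F_0$ a single edge). Then $f=(\bigsqcup F_n,(f_n),\ge)$ is an ordered premorphism $\mathcal{P}(Y,\psi,y_0,(Q_n))\to\mathcal{P}(X,\varphi,x_0,(P_n))$, and $\mathcal{P}(\alpha)=[f]$.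
   Formalization: Morphisms of SDS are taken to be surjective, since for a non-surjective α some α^{-1}(Q_n) contains empty sets, so it is not a Kakutani–Rokhlin partition and 𝒫(α) is not an ordered premorphism. *)

(* Defs.v *)
From Stdlib Require Setoid Morphisms.
From HB Require Import structures.
From mathcomp Require Import all_boot all_order all_algebra.
From mathcomp Require Import finmap.
From mathcomp Require Import boolp classical_sets functions reals topology.

Set Implicit Arguments.
Unset Strict Implicit.
Unset Printing Implicit Defensive.

Import Order.TTheory GRing.Theory Num.Theory.

(** * Categories and contravariant functors *)

Record category := Category {
  cat_obj :> Type;
  cat_hom : cat_obj -> cat_obj -> Type;
  cat_id : forall a, cat_hom a a;
  cat_comp : forall a b c, cat_hom b c -> cat_hom a b -> cat_hom a c;
  cat_comp1m : forall a b (f : cat_hom a b), cat_comp (cat_id b) f = f;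
  cat_compm1 : forall a b (f : cat_hom a b), cat_comp f (cat_id a) = f;
  cat_compA : forall a b c d (h : cat_hom c d) (g : cat_hom b c) (f : cat_hom a b),
    cat_comp h (cat_comp g f) = cat_comp (cat_comp h g) f
}.
Arguments cat_hom {c0} a b : rename.
Arguments cat_id {c0} a : rename.
Arguments cat_comp {c0 a b c} g f : rename.

Definition contravariant_functor (C D : category) (F0 : C -> D)
    (F1 : forall a b : C, cat_hom a b -> cat_hom (F0 b) (F0 a)) : Prop :=
  (forall a, F1 a a (cat_id a) = cat_id (F0 a)) /\
  (forall (a b c : C) (g : cat_hom b c) (f : cat_hom a b),
     F1 a c (cat_comp g f) = cat_comp (F1 a b f) (F1 b c g)).

(** * Ordered edge sets *)

Record edgeset (S T : finType) := EdgeSet {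
  edge :> finType;
  src : edge -> S;
  rng : edge -> T;
  ele : rel edge
}.
Arguments EdgeSet {S T}.
Arguments src {S T} e _ : rename.
Arguments rng {S T} e _ : rename.
Arguments ele {S T} e _ _ : rename.

(* A partial order for which two edges are comparable iff they have the same
   range; this is the same thing as a linear order on each fibre of [rng]. *)
Definition ordered_edgeset (S T : finType) (F : edgeset S T) : Prop :=
  [/\ reflexive (ele F), antisymmetric (ele F), transitive (ele F) &
      forall e e', ele F e e' || ele F e' e = (rng F e == rng F e')].

Definition ecomp (S T U : finType) (F : edgeset S T) (G : edgeset T U) :
    edgeset S U :=
  EdgeSet {x : F * G | rng F x.1 == src G x.2}
    (fun x => src F (val x).1)
    (fun x => rng G (val x).2)
    (fun x y => ((val x).2 != (val y).2) && ele G (val x).2 (val y).2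
             || ((val x).2 == (val y).2) && ele F (val x).1 (val y).1).

Definition eid (S : finType) : edgeset S S :=
  EdgeSet S id id (fun v w => v == w).

Definition eiso (S T : finType) (F F' : edgeset S T) : Prop :=
  exists h : F -> F',
    [/\ bijective h,
        forall e, src F' (h e) = src F e,
        forall e, rng F' (h e) = rng F e &
        forall e e', ele F' (h e) (h e') = ele F e e'].

Declare Scope edgeset_scope.
Notation "F \oE G" := (ecomp F G) (at level 40, left associativity)
  : edgeset_scope.
Notation "F =~ G" := (eiso F G) (at level 70, no associativity)
  : edgeset_scope.
Local Open Scope edgeset_scope.

(** * Ordered Bratteli diagrams *)

(* [bE n] is the edge set written E_(n+1) on paper: from V_n to V_(n+1). *)
Record obd := Obd {
  bV : nat -> finType;
  bE : forall n, edgeset (bV n) (bV n.+1);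
  bV0 : #|bV 0| = 1;
  bV_gt0 : forall n, 0 < #|bV n|;
  bE_gt0 : forall n, 0 < #|bE n|;
  b_src : forall n (v : bV n), exists e : bE n, src (bE n) e = v;
  b_rng : forall n (w : bV n.+1), exists e : bE n, rng (bE n) e = w;
  b_ord : forall n, ordered_edgeset (bE n)
}.

(* E_(k,l) for k <= l.  Peeling k by shifting the diagram avoids any cast;
   the value for l < k is a dummy. *)
Fixpoint seg_rec (V : nat -> finType) (E : forall n, edgeset (V n) (V n.+1))
    (k l : nat) {struct l} : edgeset (V k) (V l) :=
  match k, l return edgeset (V k) (V l) with
  | 0, 0 => eid (V 0)
  | 0, l'.+1 => seg_rec E 0 l' \oE E l'
  | k'.+1, l'.+1 =>
      @seg_rec (fun n => V n.+1) (fun n => E n.+1) k' l'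
  | k'.+1, 0 => EdgeSet void (of_void _) (of_void _) (fun _ _ => true)
  end.

Definition seg (B : obd) (k l : nat) : edgeset (bV B k) (bV B l) :=
  seg_rec (bE B) k l.

(** * Ordered premorphisms *)

Record prem_data (B C : obd) := PremData {
  lvl : nat -> nat;
  pF : forall n, edgeset (bV B n) (bV C (lvl n))
}.
Arguments lvl {B C} p n : rename.
Arguments pF {B C} p n : rename.

Record is_premorphism (B C : obd) (f : prem_data B C) : Prop := IsPremorphism {
  lvl0 : lvl f 0 = 0;
  lvl_homo : forall n, lvl f n <= lvl f n.+1;
  lvl_unbounded : forall N, exists n, N <= lvl f n;
  pF_gt0 : forall n, 0 < #|pF f n|;
  pF0 : #|pF f 0| = 1;
  pF_src : forall n (v : bV B n), exists e : pF f n, src (pF f n) e = v;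
  pF_rng : forall n (w : bV C (lvl f n)), exists e : pF f n, rng (pF f n) e = w;
  pF_ord : forall n, ordered_edgeset (pF f n);
  pF_comm : forall n,
    bE B n \oE pF f n.+1 =~ pF f n \oE seg C (lvl f n) (lvl f n.+1)
}.

Record premorphism (B C : obd) := Premorphism {
  prem :> prem_data B C;
  premP : is_premorphism prem
}.

Definition prem_equiv (B C : obd) (f g : premorphism B C) : Prop :=
  exists n m : nat -> nat,
    0 < n 0 /\
    forall k,
      [/\ n k < m k < n k.+1,
          lvl f (n k) < lvl g (m k) < lvl f (n k.+1),
          seg B (n k) (m k) \oE pF g (m k)
            =~ pF f (n k) \oE seg C (lvl f (n k)) (lvl g (m k)) &
          seg B (m k) (n k.+1) \oE pF f (n k.+1)
            =~ pF g (m k) \oE seg C (lvl g (m k)) (lvl f (n k.+1))].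

(** ** Isomorphism of edge sets is a congruence *)

Lemma eiso_refl S T (F : edgeset S T) : F =~ F.
Proof. by exists id; split => //; exists id. Qed.

Lemma eiso_sym S T (F G : edgeset S T) : F =~ G -> G =~ F.
Proof.
move=> [h [[h' hK h'K] hs hr ho]]; exists h'; split.
- by exists h.
- by move=> e; rewrite -hs h'K.
- by move=> e; rewrite -hr h'K.
- by move=> e e'; rewrite -ho !h'K.
Qed.

Lemma eiso_trans S T (F G H : edgeset S T) : F =~ G -> G =~ H -> F =~ H.
Proof.
move=> [h [hb hs hr ho]] [k [kb ks kr ko]]; exists (k \o h); split => /=.
- exact: bij_comp.
- by move=> e; rewrite ks hs.
- by move=> e; rewrite kr hr.
- by move=> e e'; rewrite ko ho.
Qed.

Lemma ecomp_cong S T U (F F' : edgeset S T) (G G' : edgeset T U) :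
  F =~ F' -> G =~ G' -> F \oE G =~ F' \oE G'.
Proof.
move=> [h [[h' hK h'K] hs hr ho]] [k [[k' kK k'K] ks kr ko]].
have p1 (x : F \oE G) : rng F' (h (val x).1) == src G' (k (val x).2).
  by rewrite hr ks; exact: (valP x).
have p2 (x : F' \oE G') : rng F (h' (val x).1) == src G (k' (val x).2).
  by rewrite -hr -ks h'K k'K; exact: (valP x).
pose a (x : F \oE G) : F' \oE G' :=
  exist _ (h (val x).1, k (val x).2) (p1 x).
pose b (x : F' \oE G') : F \oE G :=
  exist _ (h' (val x).1, k' (val x).2) (p2 x).
exists a; split => //=.
- exists b.
    by move=> x; apply: val_inj; rewrite /= hK kK; case: (val x).
  by move=> x; apply: val_inj; rewrite /= h'K k'K; case: (val x).
- by move=> x y; rewrite ho ko (can_eq kK).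
Qed.

#[global] Instance eiso_equivalence S T : RelationClasses.Equivalence (@eiso S T).
Proof.
split; [exact: eiso_refl|exact: eiso_sym|exact: eiso_trans].
Qed.

#[local] Hint Resolve eiso_refl : core.

#[global] Instance ecomp_proper S T U :
  Morphisms.Proper
    (Morphisms.respectful (@eiso S T)
       (Morphisms.respectful (@eiso T U) (@eiso S U)))
    (@ecomp S T U).
Proof. by move=> F F' iF G G' iG; exact: ecomp_cong. Qed.

Lemma ecompA S T U W (F : edgeset S T) (G : edgeset T U) (H : edgeset U W) :
  F \oE (G \oE H) =~ (F \oE G) \oE H.
Proof.
have p1 (x : F \oE (G \oE H)) : rng F (val x).1 == src G (val (val x).2).1.
  exact: (valP x).
have p2 (x : F \oE (G \oE H)) :
    rng (F \oE G) (exist _ ((val x).1, (val (val x).2).1) (p1 x))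
      == src H (val (val x).2).2.
  exact: (valP (val x).2).
have q1 (x : (F \oE G) \oE H) : rng G (val (val x).1).2 == src H (val x).2.
  exact: (valP x).
have q2 (x : (F \oE G) \oE H) :
    rng F (val (val x).1).1
      == src (G \oE H) (exist _ ((val (val x).1).2, (val x).2) (q1 x)).
  exact: (valP (val x).1).
pose a (x : F \oE (G \oE H)) : (F \oE G) \oE H := exist _ (_, _) (p2 x).
pose b (x : (F \oE G) \oE H) : F \oE (G \oE H) := exist _ (_, _) (q2 x).
exists a; split => //.
- exists b.
    move=> [[e [[g k] gk]] eg]; apply: val_inj => /=; congr pair.
    exact: val_inj.
  move=> [[[[e g] eg] k] gk]; apply: val_inj => /=; congr pair.
  exact: val_inj.
- move=> [[e [[g k] gk]] eg] [[e' [[g' k'] gk']] eg'] /=.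
  rewrite -val_eqE /= xpair_eqE.
  by case: (k == k'); case: (g == g'); rewrite /= ?andbT ?andbF ?orbF ?orbT.
Qed.

Lemma ecomp1e S T (F : edgeset S T) : ordered_edgeset F -> eid S \oE F =~ F.
Proof.
move=> [Frefl _ _ _]; exists (fun x => (val x).2); split => //=.
- have p (e : F) : rng (eid S) (src F e) == src F e by [].
  exists (fun e => exist _ (src F e, e) (p e)) => // -[[v e] /= ve].
  by apply: val_inj => /=; rewrite (eqP ve).
- by move=> x; rewrite -(eqP (valP x)).
- move=> [[v e] /= /eqP ->] [[v' e'] /= /eqP ->].
  case: eqP => [->|_] /=; last by rewrite orbF.
  by rewrite eqxx Frefl.
Qed.

Lemma ecompe1 S T (F : edgeset S T) : ordered_edgeset F -> F \oE eid T =~ F.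
Proof.
move=> [_ _ _ Fc]; exists (fun x => (val x).1); split => //=.
- have p (e : F) : rng F e == src (eid T) (rng F e) by [].
  exists (fun e => exist _ (e, rng F e) (p e)) => // -[[e v] /= ve].
  by apply: val_inj => /=; rewrite (eqP ve).
- by move=> x; rewrite (eqP (valP x)).
- move=> [[e v] /= /eqP <-] [[e' v'] /= /eqP <-].
  by rewrite andNb -Fc; case: (ele F e e'); rewrite ?andbF.
Qed.

Lemma eid_ord S : ordered_edgeset (eid S).
Proof.
split => /=.
- by move=> v; exact: eqxx.
- by move=> v w /andP[/eqP].
- by move=> v u w /eqP -> /eqP ->.
- by move=> v w; rewrite (eq_sym w) orbb.
Qed.

Lemma ecomp_ord S T U (F : edgeset S T) (G : edgeset T U) :
  ordered_edgeset F -> ordered_edgeset G -> ordered_edgeset (F \oE G).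
Proof.
move=> [Fr Fa Ft Fc] [Gr Ga Gt Gc]; split.
- by move=> x /=; rewrite eqxx Fr orbT.
- move=> [[e g] /= eg] [[e' g'] /= eg'] /andP[/orP h /orP h'].
  apply: val_inj => /=.
  case: h => /andP[/eqP gg le1]; case: h' => /andP[/eqP gg' le2] //.
  + by case: gg; apply: Ga; rewrite le1 le2.
  + by case: gg.
  + by case: gg'.
  + by rewrite gg (Fa e e') // le1 le2.
- move=> [[e2 g2] h2] [[e1 g1] h1] [[e3 g3] h3] /= /orP h /orP h'.
  case: h => /andP[/eqP gg le1]; case: h' => /andP[/eqP gg' le2] //.
  + rewrite (Gt _ _ _ le1 le2) andbT; case: eqP => //= g13.
    by case: gg; rewrite g13 in le1 *; apply: Ga; rewrite le1 le2.
  + by rewrite -gg' le1 andbT; move/eqP: gg ->.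
  + by rewrite gg le2 andbT; move/eqP: gg' ->.
  + by rewrite gg gg' eqxx (Ft _ _ _ le1 le2).
- move=> [[e g] /= eg] [[e' g'] /= eg']; rewrite (eq_sym g') -Gc.
  case: eqP => [gg|_] /=; last by rewrite !orbF.
  by subst g'; rewrite Gr Fc (eqP eg) (eqP eg') eqxx.
Qed.

(** ** Segments *)

Lemma segnn B k : seg B k k = eid (bV B k).
Proof.
rewrite /seg; case: B => V E _ _ _ _ _ _ /=.
by elim: k V E => //= k IH V E; rewrite IH.
Qed.

Lemma segS B k l : k <= l -> seg B k l.+1 = seg B k l \oE bE B l.
Proof.
rewrite /seg; case: B => V E _ _ _ _ _ _ /=.
by elim: k l V E => [|k IH] [|l] V E //= kl; rewrite -IH.
Qed.

Lemma seg_ord B k l : k <= l -> ordered_edgeset (seg B k l).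
Proof.
elim: l => [|l IH]; first by rewrite leqn0 => /eqP ->; rewrite segnn; exact: eid_ord.
rewrite leq_eqVlt => /predU1P[->|kl]; first by rewrite segnn; exact: eid_ord.
by rewrite segS //; apply: ecomp_ord; [exact: IH|exact: b_ord].
Qed.

Lemma seg_cat B k l m : k <= l -> l <= m ->
  seg B k l \oE seg B l m =~ seg B k m.
Proof.
move=> kl; elim: m => [|m IH].
  rewrite leqn0 => /eqP l0; subst l.
  by rewrite segnn; apply/ecompe1/seg_ord.
rewrite leq_eqVlt => /predU1P[lm|lm].
  by subst l; rewrite segnn; apply/ecompe1/seg_ord.
rewrite !segS //; last exact: leq_trans kl lm.
apply: eiso_trans (ecompA _ _ _) _.
by apply: ecomp_cong (eiso_refl _); exact: IH.
Qed.

(** ** Composition and equivalence of premorphisms *)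

Section premorphism_theory.
Variables B C : obd.
Implicit Types f g h : premorphism B C.

Lemma lvl_le f n m : n <= m -> lvl f n <= lvl f m.
Proof.
have [_ fH _ _ _ _ _ _ _] := premP f.
move=> nm; rewrite -(subnK nm); elim: (m - n) => // d IH.
exact: leq_trans IH (fH _).
Qed.

Lemma lvl_large f N : exists n0, forall n, n0 <= n -> N <= lvl f n.
Proof.
have [n0 Nn0] := lvl_unbounded (premP f) N.
by exists n0 => n nn; exact: leq_trans Nn0 (lvl_le f nn).
Qed.

Lemma prem_seg f n m : n <= m ->
  seg B n m \oE pF f m =~ pF f n \oE seg C (lvl f n) (lvl f m).
Proof.
have Ford := pF_ord (premP f).
have base k : seg B k k \oE pF f k =~ pF f k \oE seg C (lvl f k) (lvl f k).
  rewrite !segnn; apply: eiso_trans (ecomp1e (Ford k)) _.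
  exact/eiso_sym/ecompe1.
elim: m => [|m IH]; first by rewrite leqn0 => /eqP ->; exact: base.
rewrite leq_eqVlt => /predU1P[->|nm]; first exact: base.
rewrite segS //; apply: eiso_trans (eiso_sym (ecompA _ _ _)) _.
apply: eiso_trans (ecomp_cong (eiso_refl _) (pF_comm (premP f) m)) _.
apply: eiso_trans (ecompA _ _ _) _.
apply: eiso_trans (ecomp_cong (IH nm) (eiso_refl _)) _.
apply: eiso_trans (eiso_sym (ecompA _ _ _)) _.
apply: ecomp_cong (eiso_refl _) _; apply: seg_cat; exact: lvl_le.
Qed.

(* One half of [prem_equiv], required at all large levels. *)
Definition prem_half f g : Prop :=
  forall n, exists m0, forall m, m0 <= m ->
    [/\ n <= m, lvl f n <= lvl g m &
        seg B n m \oE pF g m =~ pF f n \oE seg C (lvl f n) (lvl g m)].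

Lemma prem_half_from f g n0 n m0 m :
  n0 <= n <= m0 -> m0 <= m -> lvl f n <= lvl g m0 ->
  seg B n m0 \oE pF g m0 =~ pF f n \oE seg C (lvl f n) (lvl g m0) ->
  [/\ n0 <= m, lvl f n0 <= lvl g m &
      seg B n0 m \oE pF g m =~ pF f n0 \oE seg C (lvl f n0) (lvl g m)].
Proof.
move=> /andP[n0n nm0] m0m fg i.
have fn := lvl_le f n0n; have gm := lvl_le g m0m.
have n0m0 := leq_trans n0n nm0.
split; first exact: leq_trans n0m0 m0m.
  exact: leq_trans fn (leq_trans fg gm).
rewrite -(seg_cat _ n0m0 m0m) -(seg_cat _ n0n nm0).
rewrite -ecompA (prem_seg g m0m) -ecompA (ecompA (seg B n m0)) i.
rewrite -(ecompA _ _ (seg C _ _)) (seg_cat _ fg gm) ecompA (prem_seg f n0n).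
rewrite -ecompA (seg_cat _ fn (leq_trans fg gm)); exact: eiso_refl.
Qed.

Lemma prem_equiv_sym f g : prem_equiv f g -> prem_equiv g f.
Proof.
move=> [n [m [n0 H]]]; exists m, (n \o S); split.
  by have [/andP[h _] _ _ _] := H 0; exact: leq_trans h.
move=> k /=; have [/andP[_ h1] /andP[_ h2] _ i1] := H k.
have [/andP[h3 _] /andP[h4 _] i2 _] := H k.+1.
by split => //; rewrite ?h1 ?h2.
Qed.

Lemma prem_equiv_half f g : prem_equiv f g -> prem_half f g.
Proof.
move=> [n [m [_ H]]] n0.
have kn k : k <= n k.
  elim: k => // k IH; have [/andP[h1 h2] _ _ _] := H k.
  exact: leq_ltn_trans IH (ltn_trans h1 h2).
exists (m n0) => p mp; have [/andP[h1 _] /andP[h2 _] i _] := H n0.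
by apply: prem_half_from mp (ltnW h2) i; rewrite kn ltnW.
Qed.

Lemma prem_half_equiv f g : prem_half f g -> prem_half g f -> prem_equiv f g.
Proof.
have step f' g' : prem_half f' g' -> forall n, exists m,
    [/\ n < m, lvl f' n < lvl g' m &
        seg B n m \oE pF g' m =~ pF f' n \oE seg C (lvl f' n) (lvl g' m)].
  move=> H n; have [m0 Hm0] := H n.
  have [m1 Hm1] := lvl_large g' (lvl f' n).+1.
  exists (maxn n.+1 (maxn m0 m1)).
  have [|_ _ i] := Hm0 (maxn n.+1 (maxn m0 m1)).
    by rewrite !leq_max leqnn orbT.
  split => //; first by rewrite leq_max leqnn.
  by apply: Hm1; rewrite !leq_max leqnn !orbT.
move=> /step fg /step gf.
have [u Hu] := choice fg; have [v Hv] := choice gf.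
pose n k := iter k (v \o u) 1.
exists n, (u \o n); split => // k /=.
have [a1 a2 a3] := Hu (n k); have [b1 b2 b3] := Hv (u (n k)).
by split => //; [rewrite a1 b1|rewrite a2 b2].
Qed.

Lemma prem_equivP f g : prem_equiv f g <-> prem_half f g /\ prem_half g f.
Proof.
split=> [fg|[]]; last exact: prem_half_equiv.
by split; apply: prem_equiv_half => //; exact: prem_equiv_sym.
Qed.

Lemma prem_half_trans f g h : prem_half f g -> prem_half g h -> prem_half f h.
Proof.
move=> fg gh n; have [p0 Hp] := fg n; have [np fgp i] := Hp _ (leqnn _).
have [m0 Hm] := gh p0; exists m0 => m /Hm[pm ghm j].
split; [exact: leq_trans pm|exact: leq_trans ghm|].
rewrite -(seg_cat _ np pm) -ecompA j ecompA i -ecompA.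
rewrite (seg_cat _ fgp ghm); exact: eiso_refl.
Qed.

(* In particular premorphisms that agree up to isomorphism are equivalent. *)
Lemma prem_half_iso f g : (forall n, exists e : lvl f n = lvl g n,
    ecast l (edgeset (bV B n) (bV C l)) e (pF f n) =~ pF g n) ->
  prem_half f g.
Proof.
move=> H n; exists n => m nm; split => //.
  by have [e _] := H m; rewrite -e; exact: lvl_le.
have [e] := H m; move: (prem_seg f nm).
move: (lvl g m) (pF g m) e => l G e; case: l / e G => G /= i <-.
by rewrite i.
Qed.

Lemma prem_equiv_iso f g : (forall n, exists e : lvl f n = lvl g n,
    ecast l (edgeset (bV B n) (bV C l)) e (pF f n) =~ pF g n) ->
  prem_equiv f g.
Proof.
move=> H; apply/prem_equivP; split; apply: prem_half_iso => // n.
have [e] := H n; move: (lvl g n) (pF g n) e => l G e.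
by case: l / e G => G /= i; exists erefl => /=; exact: eiso_sym.
Qed.

Lemma prem_equiv_refl f : prem_equiv f f.
Proof. by apply: prem_equiv_iso => n; exists erefl. Qed.

Lemma prem_equiv_trans f g h :
  prem_equiv f g -> prem_equiv g h -> prem_equiv f h.
Proof.
move=> /prem_equivP[fg gf] /prem_equivP[gh hg].
by apply/prem_equivP; split; [exact: prem_half_trans gh|
    exact: prem_half_trans gf].
Qed.

End premorphism_theory.

Definition pid_data (B : obd) : prem_data B B :=
  @PremData B B (fun n => n) (fun n => eid (bV B n)).

Definition pcomp_data (B C D : obd) (g : prem_data C D) (f : prem_data B C) :
    prem_data B D :=
  @PremData B D (fun n => lvl g (lvl f n))
    (fun n => pF f n \oE pF g (lvl f n)).

Lemma pid_premP B : is_premorphism (pid_data B).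
Proof.
split => //=.
- by move=> N; exists N.
- exact: bV_gt0.
- exact: bV0.
- by move=> n v; exists v.
- by move=> n v; exists v.
- by move=> n; exact: eid_ord.
- move=> n; rewrite segS // segnn.
  have En := b_ord B n; have EEn := ecomp_ord (eid_ord _) En.
  by rewrite (ecompe1 En) !ecomp1e.
Qed.

Lemma pcomp_premP B C D (g : premorphism C D) (f : premorphism B C) :
  is_premorphism (pcomp_data g f).
Proof.
have src_ex n (v : bV B n) : exists e : pF f n \oE pF g (lvl f n),
    src (pF f n \oE pF g (lvl f n)) e = v.
  have [e ev] := pF_src (premP f) v.
  have [e' ee'] := pF_src (premP g) (rng (pF f n) e).
  by exists (exist _ (e, e') (introT eqP (esym ee'))).
have card1 T : #|T : finType| = 1 -> forall x y : T, x = y.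
  by move=> /eqP /card1P /= [z zP] x y; have := zP x; have := zP y;
     rewrite !inE => /esym/eqP -> /esym/eqP ->.
split => //=.
- by rewrite (lvl0 (premP f)) (lvl0 (premP g)).
- by move=> n; apply: lvl_le; exact: lvl_homo (premP f) n.
- move=> N; have [m Nm] := lvl_unbounded (premP g) N.
  have [n mn] := lvl_unbounded (premP f) m.
  by exists n; exact: leq_trans Nm (lvl_le g mn).
- move=> n; have /card_gt0P[v _] := bV_gt0 B n.
  by have [e _] := src_ex n v; apply/card_gt0P; exists e.
- have /card_gt0P[v _] := bV_gt0 B 0; have [e _] := src_ex 0 v.
  apply/eqP/card1P; exists e => x; rewrite !inE; apply/esym/eqP/val_inj.
  have G0 : #|pF g (lvl f 0)| = 1 by rewrite (lvl0 (premP f)) (pF0 (premP g)).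
  case: (val x) (val e) => [a b] [a' b'].
  by rewrite (card1 _ (pF0 (premP f)) a a') (card1 _ G0 b b').
- move=> n w; have [e' e'w] := pF_rng (premP g) w.
  have [e ee'] := pF_rng (premP f) (src (pF g (lvl f n)) e').
  by exists (exist _ (e, e') (introT eqP ee')).
- by move=> n; apply: ecomp_ord; [exact: pF_ord (premP f) n|exact: pF_ord (premP g) _].
- move=> n; rewrite ecompA (pF_comm (premP f)) -!ecompA.
  by rewrite (prem_seg g (lvl_homo (premP f) n)).
Qed.

Definition pid (B : obd) : premorphism B B := Premorphism (pid_premP B).

Definition pcomp (B C D : obd) (g : premorphism C D) (f : premorphism B C) :
    premorphism B D := Premorphism (pcomp_premP g f).

Lemma pcomp_half B C D (g g' : premorphism C D) (f f' : premorphism B C) :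
  prem_half f f' -> prem_half g g' -> prem_half (pcomp g f) (pcomp g' f').
Proof.
move=> ff' gg' n; have [m1 H1] := ff' n; have [p0 H2] := gg' (lvl f n).
have [m2 H3] := lvl_large f' p0.
exists (maxn m1 m2) => m; rewrite geq_max => /andP[/H1[nm lm i] /H3/H2[_ lm' j]].
by split => //=; rewrite ecompA i -!ecompA j.
Qed.

Lemma pcomp_equiv B C D (g g' : premorphism C D) (f f' : premorphism B C) :
  prem_equiv f f' -> prem_equiv g g' -> prem_equiv (pcomp g f) (pcomp g' f').
Proof.
move=> /prem_equivP[ff' f'f] /prem_equivP[gg' g'g].
by apply/prem_equivP; split; exact: pcomp_half.
Qed.

(** ** The category of ordered Bratteli diagrams *)

(* A morphism is an equivalence class of premorphisms. *)
Record obd_hom (B C : obd) := ObdHom {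
  cls : premorphism B C -> Prop;
  clsP : exists f, cls = prem_equiv f
}.

Definition pclass (B C : obd) (f : premorphism B C) : obd_hom B C :=
  ObdHom (ex_intro _ f erefl).

Lemma obd_hom_eq B C (a b : obd_hom B C) : cls a = cls b -> a = b.
Proof.
by case: a b => [a aP] [b bP] /= ab; subst b; congr ObdHom; exact: Prop_irrelevance.
Qed.

Lemma pclassP B C (f g : premorphism B C) :
  pclass f = pclass g <-> prem_equiv f g.
Proof.
split=> [/(congr1 (@cls B C)) /= ->|fg]; first exact: prem_equiv_refl.
apply: obd_hom_eq => /=; apply: funext => h; apply: propext; split.
  by apply: prem_equiv_trans; exact: prem_equiv_sym.
exact: prem_equiv_trans.
Qed.

Definition prepr (B C : obd) (a : obd_hom B C) : premorphism B C :=
  sval (cid (clsP a)).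

Lemma preprK B C (a : obd_hom B C) : pclass (prepr a) = a.
Proof. by apply: obd_hom_eq; rewrite /prepr; case: cid. Qed.

Definition obd_comp (B C D : obd) (b : obd_hom C D) (a : obd_hom B C) :
    obd_hom B D := pclass (pcomp (prepr b) (prepr a)).

(* The composition does not depend on the representatives. *)
Lemma obd_compE B C D (g : premorphism C D) (f : premorphism B C) :
  obd_comp (pclass g) (pclass f) = pclass (pcomp g f).
Proof. by apply/pclassP/pcomp_equiv; apply/pclassP; rewrite preprK. Qed.

Lemma obd_comp1m B C (a : obd_hom B C) : obd_comp (pclass (pid C)) a = a.
Proof.
rewrite -{2}(preprK a) -{1}(preprK a) obd_compE; apply/pclassP.
apply: prem_equiv_iso => n /=; exists erefl => /=.
exact: ecompe1 (pF_ord (premP _) n).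
Qed.

Lemma obd_compm1 B C (a : obd_hom B C) : obd_comp a (pclass (pid B)) = a.
Proof.
rewrite -{2}(preprK a) -{1}(preprK a) obd_compE; apply/pclassP.
apply: prem_equiv_iso => n /=; exists erefl => /=.
exact: ecomp1e (pF_ord (premP _) n).
Qed.

Lemma obd_compA A B C D (c : obd_hom C D) (b : obd_hom B C) (a : obd_hom A B) :
  obd_comp c (obd_comp b a) = obd_comp (obd_comp c b) a.
Proof.
rewrite -(preprK a) -(preprK b) -(preprK c) !obd_compE; apply/pclassP.
apply: prem_equiv_iso => n /=; exists erefl => /=.
exact/eiso_sym/ecompA.
Qed.

Definition OBD : category :=
  Category obd_comp1m obd_compm1 obd_compA.

(** * Kakutani-Rokhlin partitions *)

Local Open Scope classical_set_scope.
Local Open Scope nat_scope.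

(* A partition {Z(k,j)} is recorded by the finite set of its towers
   (Z(k,1), ..., Z(k,J(k))).  Entries of towers are indexed from 0. *)
Definition towers (X : Type) := {fset seq (set X)}.

Section towers.
Variable X : topologicalType.
Implicit Types P Q : towers X.

Definition cells P : set (set X) := [set A | exists2 S, S \in P & A \in S].

Definition top P : set X := [set x | exists2 S, S \in P & last set0 S x].

Definition bottom P : set X := [set x | exists2 S, S \in P & head set0 S x].

(* The relation written P <= Q on paper. *)
Definition refined_by P Q : Prop :=
  forall B, cells Q B -> exists2 A, cells P A & B `<=` A.

(* [kr_disjoint] says that cells with distinct indices (k,j) are disjoint. *)
Record is_kr (phi : X -> X) (x0 : X) (P : towers X) : Prop := IsKR {
  kr_neq0 : forall S, S \in P -> S <> [::];
  kr_clopen : forall A, cells P A -> clopen A;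
  kr_nonempty : forall A, cells P A -> A !=set0;
  kr_cover : \bigcup_(A in cells P) A = setT;
  kr_disjoint : forall S S' j j', S \in P -> S' \in P ->
    j < size S -> j' < size S' ->
    nth set0 S j `&` nth set0 S' j' !=set0 -> S = S' /\ j = j';
  kr_step : forall S j, S \in P -> j.+1 < size S ->
    phi @` nth set0 S j = nth set0 S j.+1;
  kr_top : top P x0;
  kr_bottom : phi @` top P = bottom P
}.

End towers.

(* The condition Y_(k+j) <= Z_j for 1 <= j <= n that defines E(P,Q), for
   S = (Z_1, ..., Z_n) and T = (Y_1, ..., Y_m); in particular k + n <= m. *)
Definition tower_edge (X : Type) (S T : seq (set X)) (k : nat) : bool :=
  (k + size S <= size T) &&
  `[< forall j, j < size S -> nth set0 T (k + j) `<=` nth set0 S j >].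

Definition height (X : Type) (Q : towers X) : nat :=
  \max_(T : Q) size (val T).

(* The triples (S,T,k) with S in P, T in Q and (u(S),T,k) an edge in the
   sense of [tower_edge]; k <= height Q is no restriction. *)
Definition tower_edges (Y X : Type) (u : seq (set Y) -> seq (set X))
    (P : towers Y) (Q : towers X) : edgeset P Q :=
  EdgeSet {e : P * Q * 'I_(height Q).+1 |
            tower_edge (u (val e.1.1)) (val e.1.2) e.2}
    (fun e => (val e).1.1)
    (fun e => (val e).1.2)
    (fun e e' => ((val e).1.2 == (val e').1.2) && ((val e).2 <= (val e').2)).

Definition kr_edges (X : Type) (P Q : towers X) : edgeset P Q :=
  tower_edges id P Q.

Lemma tower_edges_ord (Y X : Type) (u : seq (set Y) -> seq (set X))
    (P : towers Y) (Q : towers X) :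
  (forall (S S' : P) (T : Q) k, tower_edge (u (val S)) (val T) k ->
     tower_edge (u (val S')) (val T) k -> S = S') ->
  ordered_edgeset (tower_edges u P Q).
Proof.
move=> uniqS; split => /=.
- by move=> e; rewrite eqxx leqnn.
- move=> [[[S T] k] /= Ee] [[[S' T'] k'] /= Ee'].
  move=> /andP[/andP[/eqP TT kk'] /andP[_ k'k]]; subst T'.
  have kE : k = k' by apply/val_inj/eqP; rewrite eqn_leq kk' k'k.
  by subst k'; apply: val_inj => /=; rewrite (uniqS _ _ _ _ Ee Ee').
- move=> e2 e1 e3 /andP[/eqP -> h] /andP[/eqP -> h'].
  by rewrite eqxx (leq_trans h h').
- move=> e e'; rewrite (eq_sym (val e').1.2) -andb_orr leq_total andbT.
  by [].
Qed.

Lemma size_height (X : Type) (Q : towers X) (T : Q) : size (val T) <= height Q.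
Proof. exact: (@leq_bigmax _ (fun T : Q => size (val T)) T). Qed.

Section tower_edge_theory.
Variables (X : topologicalType) (phi : X -> X) (x0 : X) (P Q : towers X).
Hypotheses (krP : is_kr phi x0 P) (krQ : is_kr phi x0 Q).
Hypotheses (PQ : refined_by P Q) (topPQ : top Q `<=` top P).

Lemma kr_size S : S \in P -> 0 < size S.
Proof. by move=> /(kr_neq0 krP); case: S. Qed.

Lemma kr_first S : S \in P -> nth set0 S 0 \in S.
Proof. by move=> /kr_size; exact: mem_nth. Qed.

Lemma tower_edge_first S T i : S \in P -> T \in Q -> i < size T ->
  nth set0 T i `<=` nth set0 S 0 -> tower_edge S T i.
Proof.
move=> SP TQ iT T0.
have H j : j < size S ->
    i + j < size T /\ nth set0 T (i + j) `<=` nth set0 S j.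
  elim: j => [|j IH] jS; first by rewrite addn0.
  have [ijT ijs] := IH (ltnW jS).
  have [x Tx] : nth set0 T (i + j) !=set0.
    by apply: (kr_nonempty krQ); exists T => //; exact: mem_nth.
  have ijT' : i + j.+1 < size T.
    rewrite addnS ltn_neqAle ijT andbT; apply/eqP => E.
    have [S' S'P S'x] : top P x.
      by apply: topPQ; exists T => //; rewrite -nth_last -E.
    have S'0 : 0 < size S' by exact: kr_size.
    have [||SS' jE] := kr_disjoint krP SP S'P (ltnW jS) (j' := (size S').-1).
    - by rewrite prednK.
    - by exists x; split; [exact: ijs|rewrite nth_last].
    - by move: jS; rewrite jE SS' prednK // ltnn.
  split => //; rewrite -(kr_step krP SP jS).
  by rewrite addnS in ijT' *; rewrite -(kr_step krQ TQ ijT'); exact: image_subset.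
apply/andP; split; last by apply/asboolP => j /H[].
have S0 := kr_size SP; have [|h _] := H (size S).-1; first by rewrite prednK.
by rewrite -(prednK S0) addnS.
Qed.

Lemma tower_edge_inj S S' T k : S \in P -> S' \in P -> T \in Q ->
  tower_edge S T k -> tower_edge S' T k -> S = S'.
Proof.
move=> SP S'P TQ /andP[kS /asboolP eS] /andP[kS' /asboolP eS'].
have S0 := kr_size SP; have S'0 := kr_size S'P.
have [x Tx] : nth set0 T (k + 0) !=set0.
  apply: (kr_nonempty krQ); exists T => //; apply: mem_nth.
  by rewrite addn0 (leq_trans _ kS) // -{1}(addn0 k) ltn_add2l.
have [] // := kr_disjoint krP SP S'P S0 S'0.
by exists x; split; [exact: eS|exact: eS'].
Qed.

Lemma kr_edges_ord : ordered_edgeset (kr_edges P Q).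
Proof.
apply: tower_edges_ord => S S' T k E E'; apply: val_inj.
exact: tower_edge_inj (valP S) (valP S') (valP T) E E'.
Qed.

Lemma kr_edges_mk (S : P) (T : Q) i : tower_edge (val S) (val T) i ->
  exists e : kr_edges P Q, src _ e = S /\ rng _ e = T.
Proof.
move=> E; have ih : i < (height Q).+1.
  rewrite ltnS (leq_trans _ (size_height T)) //.
  by case/andP: E => /(leq_trans (leq_addr _ _)).
by exists (exist _ (S, T, Ordinal ih) E).
Qed.

Lemma kr_edges_src (S : P) : exists e : kr_edges P Q, src _ e = S.
Proof.
have [x Sx] : nth set0 (val S) 0 !=set0.
  by apply: (kr_nonempty krP); exists (val S); [exact: valP|exact/kr_first/valP].
have [B [T TQ BT] Bx] : (\bigcup_(A in cells Q) A) x by rewrite (kr_cover krQ).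
have [A [S' S'P AS'] BA] : exists2 A, cells P A & B `<=` A.
  by apply: PQ; exists T.
have [SS' jE] : val S = S' /\ 0 = index A S'.
  apply: (kr_disjoint krP) => //; [exact: valP|exact/kr_size/valP| |].
    by rewrite index_mem.
  by exists x; split => //; rewrite nth_index //; exact: BA.
have E : tower_edge (val S) T (index B T).
  apply: tower_edge_first; rewrite ?index_mem // ?(valP S) //.
  by rewrite nth_index // SS' jE nth_index.
have [e [eS _]] := @kr_edges_mk S [` TQ]%fset _ E.
by exists e.
Qed.

Lemma kr_edges_rng (T : Q) : exists e : kr_edges P Q, rng _ e = T.
Proof.
have TQ := valP T; have T0 : 0 < size (val T).
  by have := kr_neq0 krQ TQ; case: (val T).
have cT : cells Q (nth set0 (val T) 0) by exists (val T) => //; exact: mem_nth.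
have [x Tx] := kr_nonempty krQ cT.
have : (phi @` top Q) x.
  by rewrite (kr_bottom krQ); exists (val T) => //; rewrite -nth0.
move=> [z /topPQ zP zx]; have : bottom P x by rewrite -(kr_bottom krP); exists z.
move=> [S SP]; rewrite -nth0 => Sx.
have [A [S' S'P AS'] TA] := PQ cT.
have [SS' jE] : S = S' /\ 0 = index A S'.
  apply: (kr_disjoint krP) => //; [exact: kr_size|by rewrite index_mem|].
  by exists x; split => //; rewrite nth_index //; exact: TA.
have E : tower_edge S (val T) 0.
  have AE : nth set0 S 0 = A by rewrite SS' jE nth_index.
  by apply: tower_edge_first => //; rewrite AE.
have [e [_ eT]] := @kr_edges_mk [` SP]%fset T _ E.
by exists e.
Qed.

End tower_edge_theory.

(** * The category of essentially minimal systems *)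

Definition metrizable (R : realType) (X : topologicalType) : Prop :=
  exists d : X -> X -> R,
    [/\ forall x y, d x y = 0%R <-> x = y,
        forall x y, d x y = d y x,
        forall x y z, (d x z <= d x y + d y z)%R &
        forall x, nbhs x =
          filter_from [set e : R | (0 < e)%R] (fun e => [set y | (d x y < e)%R])].

Definition homeomorphism (X : topologicalType) (phi : X -> X) : Prop :=
  continuous phi /\
  exists psi : X -> X, [/\ continuous psi, cancel phi psi & cancel psi phi].

Definition invariant_closed (X : topologicalType) (phi : X -> X) (M : set X) :
  Prop := [/\ M !=set0, closed M & phi @` M = M].

Definition minimal_set (X : topologicalType) (phi : X -> X) (M : set X) : Prop :=
  invariant_closed phi M /\
  forall N, invariant_closed phi N -> N `<=` M -> N = M.

Record sds (R : realType) := Sds {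
  sX :> topologicalType;
  sphi : sX -> sX;
  sx0 : sX;
  sP : nat -> towers sX;
  s_metrizable : metrizable R sX;
  s_compact : compact [set: sX];
  s_tot_disc : totally_disconnected [set: sX];
  s_homeo : homeomorphism sphi;
  s_minimal : exists2 M, M sx0 & forall N, minimal_set sphi N <-> N = M;
  s_kr : forall n, is_kr sphi sx0 (sP n);
  s_P0 : sP 0 = [fset [:: [set: sX]]]%fset;
  s_refined : forall n, refined_by (sP n) (sP n.+1);
  s_tops : forall n, 0 < n -> top (sP n.+1) `<=` top (sP n);
  s_tops_cap : \bigcap_(n in [set n | 0 < n]) top (sP n) = [set sx0];
  s_basis : basis [set A | exists n, cells (sP n) A]
}.
Arguments sphi {R} s _ : rename.
Arguments sx0 {R} s : rename.
Arguments sP {R} s n : rename.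

Record sds_hom (R : realType) (X Y : sds R) := SdsHom {
  sfun :> X -> Y;
  sfun_cont : continuous sfun;
  sfun_comm : forall x, sfun (sphi X x) = sphi Y (sfun x);
  sfun_x0 : sfun (sx0 X) = sx0 Y;
  (* Exactly what makes the inverse images of the cells of the partitions of
     [Y] non-empty, hence again Kakutani-Rokhlin partitions.  Without it there
     may be no premorphism at all between the diagrams, e.g. for the inclusion
     of the fixed point in the one-point compactification of the integers
     with the map n |-> n + 1. *)
  sfun_surj : forall y, exists x, sfun x = y
}.

Section SDS.
Variable R : realType.

Lemma sds_hom_eq (X Y : sds R) (f g : sds_hom X Y) :
  (forall x, f x = g x) -> f = g.
Proof.
move=> /funext fg; case: f g fg => f f1 f2 f3 f4 [g g1 g2 g3 g4] /= fg.
by subst g; congr SdsHom; exact: Prop_irrelevance.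
Qed.

Definition sds_id (X : sds R) : sds_hom X X.
Proof.
refine (@SdsHom R X X id _ _ _ _) => //.
- by move=> x; exact: cvg_id.
- by move=> y; exists y.
Defined.

Definition sds_comp (X Y Z : sds R) (g : sds_hom Y Z) (f : sds_hom X Y) :
  sds_hom X Z.
Proof.
refine (@SdsHom R X Z (g \o f) _ _ _ _).
- by move=> x; apply: continuous_comp; exact: sfun_cont.
- by move=> x /=; rewrite !sfun_comm.
- by rewrite /= !sfun_x0.
- move=> z; have [y <-] := sfun_surj g z; have [x <-] := sfun_surj f y.
  by exists x.
Defined.

Definition SDS : category.
Proof.
refine (@Category (sds R) (@sds_hom R) sds_id sds_comp _ _ _);
  by move=> *; exact: sds_hom_eq.
Defined.

End SDS.

(** * The map P *)

Section Pobj.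
Variables (R : realType) (X : sds R).

Lemma s_top_shrink n : top (sP X n.+1) `<=` top (sP X n).
Proof.
case: n => [|n]; last exact: s_tops.
rewrite s_P0 => x _; exists [:: setT] => //.
by rewrite inE.
Qed.

Let V n : finType := sP X n.
Let E n : edgeset (V n) (V n.+1) := kr_edges (sP X n) (sP X n.+1).

Lemma Pobj_V0 : #|V 0| = 1.
Proof. by rewrite /V -cardfE s_P0 cardfs1. Qed.

Lemma Pobj_V_gt0 n : 0 < #|V n|.
Proof.
have [T TP _] := kr_top (s_kr X n); rewrite /V -cardfE.
by rewrite cardfs_gt0; apply/fset0Pn; exists T.
Qed.

Lemma Pobj_src n (v : V n) : exists e : E n, src (E n) e = v.
Proof.
exact: kr_edges_src (s_kr X n) (s_kr X n.+1) (@s_refined R X n)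
  (@s_top_shrink n) v.
Qed.

Lemma Pobj_rng n (w : V n.+1) : exists e : E n, rng (E n) e = w.
Proof.
exact: kr_edges_rng (s_kr X n) (s_kr X n.+1) (@s_refined R X n)
  (@s_top_shrink n) w.
Qed.

Lemma Pobj_E_gt0 n : 0 < #|E n|.
Proof.
have /card_gt0P[v _] := Pobj_V_gt0 n; have [e _] := Pobj_src v.
by apply/card_gt0P; exists e.
Qed.

Lemma Pobj_ord n : ordered_edgeset (E n).
Proof. exact: kr_edges_ord (s_kr X n) (s_kr X n.+1). Qed.

Definition Pobj : obd :=
  @Obd V E Pobj_V0 Pobj_V_gt0 Pobj_E_gt0 Pobj_src Pobj_rng Pobj_ord.

End Pobj.

Definition kr_preimage (X Y : Type) (alpha : X -> Y) (Q : towers Y) : towers X :=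
  [fset [seq alpha @^-1` A | A <- S] | S in Q]%fset.

Section Pmor.
Variables (R : realType) (X Y : sds R) (alpha : sds_hom X Y).

Record admissible (s : nat -> nat) : Prop := Admissible {
  adm0 : s 0 = 0;
  adm_homo : forall n, s n <= s n.+1;
  adm_unbounded : forall N, exists n, N <= s n;
  adm_refined : forall n,
    refined_by (kr_preimage alpha (sP Y n)) (sP X (s n));
  adm_top : forall n, top (sP X (s n)) `<=` top (kr_preimage alpha (sP Y n))
}.

(* Its n-th edge set consists of the (S,T,k) such that (alpha^-1(S),T,k) is in
   E(alpha^-1(Q_n), P_(s n)). *)
Definition Pmor_data (s : nat -> nat) : prem_data (Pobj Y) (Pobj X) :=
  @PremData (Pobj Y) (Pobj X) s
    (fun n => tower_edges (map (preimage alpha)) (sP Y n) (sP X (s n))).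

End Pmor.

(* Main.v *)
Require Import Defs.
From mathcomp Require Import all_boot all_order all_algebra finmap.
From mathcomp Require Import boolp classical_sets functions reals topology.
From mathcomp Require Import cardinality.

(* Everything reduces to one fact about edge sets: if P, Q, O are
   Kakutani-Rokhlin partitions of Y, X, W and alpha : X -> Y, beta : W -> X,
   then E(alpha^-1(P),Q) o E(beta^-1(Q),O) is isomorphic to
   E((alpha beta)^-1(P),O) through (S,T,k),(T,U,l) |-> (S,U,l+k).  This is a
   bijection because an occurrence of S in U starts in exactly one occurrence of
   a tower T of Q in U, and it preserves the order because the occurrences in
   U of the towers of Q do not overlap.  With identities for alpha or beta it
   identifies the segments of a diagram with E(P_n,P_m) and yields the
   premorphism axioms, the independence of the chosen levels, and the
   compatibility with composition.  Admissible levels exist by compactness: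
   the sets of points where the n-th partition is already fine enough form
   an increasing open cover. *)

Set Implicit Arguments.
Unset Strict Implicit.
Unset Printing Implicit Defensive.

Local Open Scope classical_set_scope.
Local Open Scope nat_scope.
Local Open Scope edgeset_scope.

(** * Positions of towers inside the towers of a finer partition *)

Section tower_edge_location.
Variables (X : topologicalType) (phi : X -> X) (x0 : X) (P Q : towers X).
Hypotheses (krP : is_kr phi x0 P) (krQ : is_kr phi x0 Q).
Hypothesis topPQ : top Q `<=` top P.

Lemma kr_cell_nth S j : S \in P -> j < size S -> cells P (nth set0 S j).
Proof. by move=> SP jS; exists S => //; exact: mem_nth. Qed.

Lemma cellsP A : cells P A ->
  exists S j, [/\ S \in P, j < size S & A = nth set0 S j].
Proof.
by move=> [S SP AS]; exists S, (index A S); rewrite index_mem nth_index.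
Qed.

Lemma cell_inter A B x : cells P A -> cells P B -> A x -> B x -> A = B.
Proof.
move=> /cellsP[S [j [SP jS ->]]] /cellsP[S' [j' [S'P jS' ->]]] Ax Bx.
by have [|-> ->] := kr_disjoint krP SP S'P jS jS'; first by exists x.
Qed.

Lemma ex_cell x : exists2 A, cells P A & A x.
Proof.
have [A PA Ax] : (\bigcup_(A in cells P) A) x by rewrite (kr_cover krP).
by exists A.
Qed.

(* If the bottom cell of T met a cell of S that is not its bottom cell, this
   would contradict phi(top) = bottom in P and Q. *)
Lemma tower_edge_at S T i j : injective phi ->
  S \in P -> T \in Q -> i < size T -> j < size S ->
  nth set0 T i `<=` nth set0 S j -> j <= i /\ tower_edge S T (i - j).
Proof.
move=> phiI SP TQ; elim: j i => [|j IH] i iT jS TS.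
  by rewrite subn0; split => //; exact: (tower_edge_first krP krQ topPQ).
case: i iT TS => [|i] iT TS.
  have [|x Tx] := kr_nonempty krQ (A := nth set0 T 0).
    by exists T => //; exact: mem_nth.
  have : (phi @` top Q) x.
    by rewrite (kr_bottom krQ); exists T => //; rewrite -nth0.
  move=> [z /topPQ zP zx].
  have [S' S'P] : bottom P x by rewrite -(kr_bottom krP); exists z.
  rewrite -nth0 => S'x.
  have [|_] // := kr_disjoint krP SP S'P jS (kr_size krP S'P).
  by exists x; split => //; exact: TS.
rewrite subSS ltnS; apply: IH => //; [exact: ltnW|exact: ltnW|].
move=> x Tx; have : nth set0 S j.+1 (phi x).
  by apply: TS; rewrite -(kr_step krQ TQ iT); exists x.
by rewrite -(kr_step krP SP jS) => -[y Sy /phiI <-].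
Qed.

(** An overlap would put one cell of T both into the bottom cell of S' and into the cell of S at
    index k' - k > 0, against disjointness. *)
Lemma tower_edge_sep S S' T k k' : S \in P -> S' \in P -> T \in Q ->
  tower_edge S T k -> tower_edge S' T k' -> k < k' -> k + size S <= k'.
Proof.
move=> SP S'P TQ /andP[kS /asboolP eS] /andP[kS' /asboolP eS'] kk'.
have S'0 := kr_size krP S'P.
rewrite leqNgt; apply/negP => k'S.
have jS : k' - k < size S by rewrite ltn_subLR // ltnW.
have k'T : k' < size T by rewrite (leq_trans _ kS') // -{1}(addn0 k') ltn_add2l.
have [x Tx] : nth set0 T k' !=set0.
  by apply: (kr_nonempty krQ); exists T => //; exact: mem_nth.
have [|_ /eqP] := kr_disjoint krP SP S'P jS S'0.
  exists x; split; last by apply: eS' => //; rewrite addn0.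
  by apply: eS => //; rewrite subnKC // ltnW.
by rewrite subn_eq0 leqNgt kk'.
Qed.

End tower_edge_location.

Lemma tower_edges_mk (X Y : Type) (u : seq (set Y) -> seq (set X))
    (P : towers Y) (Q : towers X) (S : P) (T : Q) k :
  tower_edge (u (val S)) (val T) k ->
  exists e : tower_edges u P Q,
    [/\ src _ e = S, rng _ e = T & (val e).2 = k :> nat].
Proof.
move=> E; have kh : k < (height Q).+1.
  rewrite ltnS (leq_trans _ (size_height T)) //.
  by case/andP: E => /(leq_trans (leq_addr _ _)).
by exists (exist _ (S, T, Ordinal kh) E).
Qed.

(** * Inverse images of Kakutani-Rokhlin partitions *)

Section kr_preimage.
Variables (R : realType) (X Y : sds R) (alpha : sds_hom X Y).
Implicit Type P : towers Y.

Lemma sphi_inj (Z : sds R) : injective (sphi Z).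
Proof. by have [_ [psi [_ phiK _]]] := s_homeo Z; exact: can_inj phiK. Qed.

Lemma sphi_surj (Z : sds R) (z : Z) : exists z', sphi Z z' = z.
Proof. by have [_ [psi [_ _ psiK]]] := s_homeo Z; exists (psi z). Qed.

Lemma preimage_sds_inj : injective (preimage alpha).
Proof.
move=> A B AB; apply/seteqP; split => y; have [x <-] := sfun_surj alpha y.
  by change ((alpha @^-1` A) x -> B (alpha x)); rewrite AB.
by change ((alpha @^-1` B) x -> A (alpha x)); rewrite -AB.
Qed.

Lemma mem_kr_preimage P S : S \in P ->
  [seq alpha @^-1` A | A <- S] \in kr_preimage alpha P.
Proof. by move=> SP; apply/imfsetP; exists S. Qed.

Lemma nth_preimage (S : seq (set Y)) j :
  nth set0 [seq alpha @^-1` A | A <- S] j = alpha @^-1` nth set0 S j.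
Proof.
have [jS|Sj] := ltnP j (size S); first by rewrite (nth_map set0).
(* Past the end both entries are the default [set0], whose inverse image is empty. *)
by rewrite !nth_default ?size_map // preimage_set0.
Qed.

Lemma cells_kr_preimage P B :
  cells (kr_preimage alpha P) B <-> exists2 A, cells P A & B = alpha @^-1` A.
Proof.
split=> [[_ /imfsetP[S /= SP ->] /mapP[A AS ->]]|[A [S SP AS] ->]].
  by exists A => //; exists S.
by exists [seq alpha @^-1` A | A <- S]; [exact: mem_kr_preimage|exact: map_f].
Qed.

Lemma top_kr_preimage P : top (kr_preimage alpha P) = alpha @^-1` top P.
Proof.
apply/seteqP; split => x.
  move=> [_ /imfsetP[S /= SP ->]]; rewrite -nth_last nth_preimage size_map.
  by move=> Sx; exists S => //; rewrite -nth_last.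
move=> [S SP Sx]; exists [seq alpha @^-1` A | A <- S].
  exact: mem_kr_preimage.
by rewrite -nth_last nth_preimage size_map nth_last.
Qed.

Lemma bottom_kr_preimage P :
  bottom (kr_preimage alpha P) = alpha @^-1` bottom P.
Proof.
apply/seteqP; split => x.
  move=> [_ /imfsetP[S /= SP ->]]; rewrite -nth0 nth_preimage nth0.
  by move=> Sx; exists S.
move=> [S SP Sx]; exists [seq alpha @^-1` A | A <- S].
  exact: mem_kr_preimage.
by rewrite -nth0 nth_preimage nth0.
Qed.

(** For the inclusion from right to left, a point is lifted along [sphi X], which is onto, and the
    injectivity of [sphi Y] shows that alpha sends the lift into A. *)
Lemma sphi_preimage (A : set Y) :
  sphi X @` (alpha @^-1` A) = alpha @^-1` (sphi Y @` A).
Proof.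
apply/seteqP; split => x.
  by move=> [x' Ax' <-]; exists (alpha x') => //; rewrite sfun_comm.
move=> [y Ay yx]; have [x' x'x] := sphi_surj x; exists x' => //.
by move: yx; rewrite -x'x sfun_comm => /sphi_inj yx; rewrite /preimage /= -yx.
Qed.

(** Surjectivity of alpha keeps the cells non-empty; the conditions involving the homeomorphism
    transfer by [sphi_preimage]. *)
Lemma kr_preimageP P : is_kr (sphi Y) (sx0 Y) P ->
  is_kr (sphi X) (sx0 X) (kr_preimage alpha P).
Proof.
move=> krP; split.
- move=> _ /imfsetP[S /= SP ->]; have := kr_size krP SP.
  by case: S SP.
- move=> _ /cells_kr_preimage[A /(kr_clopen krP) cA ->].
  exact: preimage_clopen cA (@sfun_cont _ _ _ alpha).
- move=> _ /cells_kr_preimage[A /(kr_nonempty krP) [y Ay] ->].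
  by have [x xy] := sfun_surj alpha y; exists x; rewrite /preimage /= xy.
- apply/seteqP; split => // x _; have [A PA Ax] := ex_cell krP (alpha x).
  by exists (alpha @^-1` A) => //; apply/cells_kr_preimage; exists A.
- move=> _ _ j j' /imfsetP[S /= SP ->] /imfsetP[S' /= S'P ->].
  rewrite !size_map !nth_preimage => jS jS' [x [Sx S'x]].
  by have [|-> ->] := kr_disjoint krP SP S'P jS jS'; first by exists (alpha x).
- move=> _ j /imfsetP[S /= SP ->]; rewrite size_map !nth_preimage => jS.
  by rewrite sphi_preimage (kr_step krP SP jS).
- by rewrite top_kr_preimage /preimage /= sfun_x0; exact: kr_top krP.
- by rewrite top_kr_preimage bottom_kr_preimage sphi_preimage (kr_bottom krP).
Qed.

End kr_preimage.


(** * Edge sets between a pulled-back partition and a finer one *)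

(** The two conditions under which E(alpha^-1(P), Q) makes sense; admissibility asks for them at
    every level. *)
Definition subordinate (R : realType) (X Y : sds R) (alpha : sds_hom X Y)
    (P : towers Y) (Q : towers X) : Prop :=
  refined_by (kr_preimage alpha P) Q /\ top Q `<=` top (kr_preimage alpha P).

Section subordinate.
Variables (R : realType) (X Y : sds R) (alpha : sds_hom X Y).
Variables (P : towers Y) (Q : towers X).
Hypotheses (krP : is_kr (sphi Y) (sx0 Y) P) (krQ : is_kr (sphi X) (sx0 X) Q).
Hypothesis PQ : subordinate alpha P Q.
Let krP' := kr_preimageP alpha krP.

Lemma tower_edge_preimage_inj S S' T k : S \in P -> S' \in P -> T \in Q ->
  tower_edge (map (preimage alpha) S) T k ->
  tower_edge (map (preimage alpha) S') T k -> S = S'.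
Proof.
move=> SP S'P TQ e e'; apply: (inj_map (@preimage_sds_inj _ _ _ alpha)).
exact: (tower_edge_inj krP' krQ (mem_kr_preimage _ SP)
  (mem_kr_preimage _ S'P)) e e'.
Qed.

Lemma sub_edges_ord : ordered_edgeset (tower_edges (map (preimage alpha)) P Q).
Proof.
apply: tower_edges_ord => S S' T k E E'; apply: val_inj.
exact: tower_edge_preimage_inj (valP S) (valP S') (valP T) E E'.
Qed.

(** An edge of [kr_edges] leaving alpha^-1(S) satisfies the very condition that defines an edge
    leaving S. *)
Lemma sub_edges_src (S : P) :
  exists e : tower_edges (map (preimage alpha)) P Q, src _ e = S.
Proof.
have [[[[S' T] k] /= E] /= S'E] := kr_edges_src krP' krQ PQ.1 PQ.2
  [` mem_kr_preimage alpha (valP S)]%fset.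
by move: E; rewrite S'E => E; exists (exist _ (S, T, k) E).
Qed.

Lemma sub_edges_rng (T : Q) :
  exists e : tower_edges (map (preimage alpha)) P Q, rng _ e = T.
Proof.
have [[[[S' T'] k] /= E] /= T'E] := kr_edges_rng krP' krQ PQ.1 PQ.2 T.
have /imfsetP[S /= SP S'E] := valP S'.
by move: E; rewrite T'E S'E => E; exists (exist _ ([` SP]%fset, T, k) E).
Qed.

(** Refinement places the cell inside a cell of alpha^-1(P); [tower_edge_at] enlarges this to an
    occurrence of the whole tower. *)
Lemma sub_edge_at T i : T \in Q -> i < size T ->
  exists S j, [/\ S \in P, j < size S, j <= i,
    nth set0 T i `<=` alpha @^-1` nth set0 S j &
    tower_edge (map (preimage alpha) S) T (i - j)].
Proof.
move=> TQ iT; have [A /cells_kr_preimage[B /cellsP[S [j [SP jS ->]]] ->] TA] :=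
  PQ.1 _ (kr_cell_nth TQ iT).
have jS' : j < size (map (preimage alpha) S) by rewrite size_map.
have TS : nth set0 T i `<=` nth set0 (map (preimage alpha) S) j.
  by rewrite nth_preimage.
have [ji E] := tower_edge_at krP' krQ PQ.2 (@sphi_inj _ X)
  (mem_kr_preimage alpha SP) TQ iT jS' TS.
by exists S, j.
Qed.

End subordinate.

(** * Composition of edge sets *)

Section edge_composition.
Variables (R : realType) (W X Y : sds R).
Variables (alpha : sds_hom X Y) (beta : sds_hom W X).
Variables (P : towers Y) (Q : towers X) (O : towers W).
Hypotheses (krP : is_kr (sphi Y) (sx0 Y) P) (krQ : is_kr (sphi X) (sx0 X) Q).
Hypothesis krO : is_kr (sphi W) (sx0 W) O.
Hypotheses (PQ : subordinate alpha P Q) (QO : subordinate beta Q O).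
Let krP' := kr_preimageP alpha krP.
Let krQ' := kr_preimageP beta krQ.
Let gamma := sds_comp alpha beta.

Lemma subordinate_comp : subordinate gamma P O.
Proof.
split=> [C OC|w Ow].
  have [_ /cells_kr_preimage[B QB ->] CB] := QO.1 _ OC.
  have [_ /cells_kr_preimage[A PA ->] BA] := PQ.1 _ QB.
  exists (gamma @^-1` A); first by apply/cells_kr_preimage; exists A.
  by move=> w /CB /BA.
have := QO.2 _ Ow; rewrite !top_kr_preimage => /PQ.2.
by rewrite top_kr_preimage.
Qed.

Lemma tower_edge_trans S T U k l : S \in P -> T \in Q -> U \in O ->
  tower_edge (map (preimage alpha) S) T k ->
  tower_edge (map (preimage beta) T) U l ->
  tower_edge (map (preimage gamma) S) U (l + k).
Proof.
move=> SP TQ UO /andP[]; rewrite !size_map => kT /asboolP ST.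
move=> /andP[]; rewrite ?size_map => lU /asboolP TU.
apply/andP; rewrite !size_map; split.
  by rewrite -addnA (leq_trans _ lU) // leq_add2l.
apply/asboolP => j jS w Uw; rewrite nth_preimage.
have kjT : k + j < size T by rewrite (leq_trans _ kT) // ltn_add2l.
have := TU (k + j); rewrite addnA nth_preimage => /(_ kjT _ Uw) Tw.
by have := ST j; rewrite nth_preimage => /(_ jS _ Tw).
Qed.

(** This gives surjectivity on edges. T is the tower of Q whose occurrence in U covers position m,
    with its cell of index k there. The cell of P containing the image of that cell meets the bottom
    cell of S, hence equals it, so S starts in T at k. *)
Lemma tower_edge_split S U m : S \in P -> U \in O ->
  tower_edge (map (preimage gamma) S) U m ->
  exists T k, [/\ T \in Q, k <= m, tower_edge (map (preimage alpha) S) T k &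
    tower_edge (map (preimage beta) T) U (m - k)].
Proof.
move=> SP UO /andP[]; rewrite size_map => mU /asboolP SU.
have S0 := kr_size krP SP.
have mU' : m < size U by rewrite (leq_trans _ mU) // -{1}(addn0 m) ltn_add2l.
have [T [j [TQ jT jm UT E]]] := sub_edge_at krQ krO QO UO mU'.
exists T, j; split => //.
have [A /cells_kr_preimage[B PB ->] TB] := PQ.1 _ (kr_cell_nth TQ jT).
have [w Uw] := kr_nonempty krO (kr_cell_nth UO mU').
have BS : B = nth set0 S 0.
  apply: (cell_inter krP PB (kr_cell_nth SP S0) (x := gamma w)).
    by apply: TB; exact: UT.
  have := SU 0; rewrite addn0 nth_preimage; exact.
apply: (tower_edge_first krP' krQ PQ.2) => //; first exact: mem_kr_preimage.
by rewrite nth_preimage -BS.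
Qed.

(** By [tower_edge_sep] the occurrence of T in U ends no later than l', and S starts strictly before
    T ends. *)
Lemma tower_edge_lt S S' T T' U k k' l l' : S \in P -> S' \in P ->
  T \in Q -> T' \in Q -> U \in O ->
  tower_edge (map (preimage alpha) S) T k ->
  tower_edge (map (preimage beta) T) U l ->
  tower_edge (map (preimage alpha) S') T' k' ->
  tower_edge (map (preimage beta) T') U l' ->
  l < l' -> l + k < l' + k'.
Proof.
move=> SP S'P TQ T'Q UO ST TU ST' TU' ll'.
have := tower_edge_sep krQ' krO (mem_kr_preimage _ TQ) (mem_kr_preimage _ T'Q)
  UO TU TU' ll'; rewrite size_map => lT.
have /andP[] := ST; rewrite size_map => kT _.
apply: leq_trans (leq_addr _ _); apply: leq_trans lT.
rewrite ltn_add2l; apply: leq_trans kT.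
by rewrite -{1}(addn0 k) ltn_add2l; exact: (kr_size krP SP).
Qed.

(** Positions in U thus reproduce the lexicographic order of a composite edge set, in which the
    second edge counts first. *)
Lemma tower_edge_le S S' T T' U k k' l l' : S \in P -> S' \in P ->
  T \in Q -> T' \in Q -> U \in O ->
  tower_edge (map (preimage alpha) S) T k ->
  tower_edge (map (preimage beta) T) U l ->
  tower_edge (map (preimage alpha) S') T' k' ->
  tower_edge (map (preimage beta) T') U l' ->
  (l + k <= l' + k') = (l < l') || (l == l') && (k <= k').
Proof.
move=> SP S'P TQ T'Q UO ST TU ST' TU'.
case: (ltngtP l l') => [ll'|l'l|->]; last by rewrite leq_add2l.
  by rewrite ltnW // (tower_edge_lt SP S'P TQ T'Q UO ST TU ST' TU').
by rewrite leqNgt (tower_edge_lt S'P SP T'Q TQ UO ST' TU' ST TU).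
Qed.

Lemma sub_edges_comp :
  tower_edges (map (preimage alpha)) P Q
    \oE tower_edges (map (preimage beta)) Q O
  =~ tower_edges (map (preimage gamma)) P O.
Proof.
set F := tower_edges _ P Q; set G := tower_edges _ Q O.
have H (x : F \oE G) : exists e : tower_edges (map (preimage gamma)) P O,
    [/\ src _ e = src _ x, rng _ e = rng _ x &
        (val e).2 = (val (val x).2).2 + (val (val x).1).2 :> nat].
  case: x => [[[[[S T] k] /= ST] [[[T' U] l] /= TU]] /= /eqP TT'].
  rewrite /= in TT'; subst T'; apply: tower_edges_mk.
  exact: tower_edge_trans (valP S) (valP T) (valP U) ST TU.
have [h hP] := choice H.
have hs x : src _ (h x) = src _ x by have [] := hP x.
have hr x : rng _ (h x) = rng _ x by have [] := hP x.
have hk x : (val (h x)).2 = (val (val x).2).2 + (val (val x).1).2 :> nat.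
  by have [] := hP x.
have ho x y : ele _ (h x) (h y) = ele (F \oE G) x y.
  rewrite [LHS]/ele /=; move: (hr x) (hr y) (hk x) (hk y) => /= -> -> -> ->.
  case: x y => [[[[[S T] k] /= ST] [[[T1 U] l] /= TU]] /= /eqP TT1].
  rewrite /= in TT1; subst T1.
  move=> [[[[[S' T'] k'] /= ST'] [[[T1 U'] l'] /= TU']] /= /eqP TT1].
  rewrite /= in TT1; subst T1.
  case: eqP => [UU|UU] /=; last first.
    rewrite !andbF /=; apply/esym/negP.
    move=> /andP[/eqP/(congr1 val) /= [_ UU' _] _].
    exact: UU.
  subst U'; rewrite (tower_edge_le (valP S) (valP S') (valP T) (valP T')
    (valP U) ST TU ST' TU') -!val_eqE /= !xpair_eqE eqxx andbT.
  have lE : (l == l') = (l == l' :> nat) by [].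
  (* At equal positions in U the towers T and T' coincide, so the second edges are equal and the
     first ones decide. *)
  have lT : l == l' :> nat -> T = T'.
    move=> /eqP/val_inj ll; subst l'; apply: val_inj.
    exact: (tower_edge_preimage_inj krQ krO (valP T) (valP T') (valP U)) TU TU'.
  rewrite lE [l < l']ltn_neqAle.
  case: (boolP (l == l' :> nat)) => [/lT <-|_] /=; first by rewrite !eqxx.
  by rewrite !andbF.
(* Since [h] reflects the order, edges with equal images are related both ways, and antisymmetry
   identifies them. *)
have hI : injective h.
  have [_ FGa _ _] := ecomp_ord (sub_edges_ord alpha krP krQ)
    (sub_edges_ord beta krQ krO).
  have [FGr _ _ _] := sub_edges_ord gamma krP krO.
  by move=> x y xy; apply: FGa; rewrite -!ho xy FGr.
have hS e : exists x, h x = e.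
  case: e => [[[S U] m] /= E].
  have [T [k [TQ km ST TU]]] := tower_edge_split (valP S) (valP U) E.
  have [e1 [e1S e1T e1k]] := @tower_edges_mk _ _ _ P Q S [` TQ]%fset k ST.
  have [e2 [e2T e2U e2k]] :=
    @tower_edges_mk _ _ _ Q O [` TQ]%fset U (m - k) TU.
  have e12 : rng F e1 == src G e2 by rewrite e1T e2T.
  exists (exist _ (e1, e2) e12); set x : F \oE G := exist _ _ _.
  apply: val_inj; move: (hs x) (hr x) (hk x) => /=.
  case: (h x) => [[[S' U'] m'] E'] /= -> -> m'E; rewrite /= in e1S e2U.
  by congr (_, _, _) => //; apply: val_inj; rewrite /= m'E e1k e2k subnK.
have [g gK] := choice hS.
exists h; split => //; exists g => // x; apply: hI; exact: gK.
Qed.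

End edge_composition.

(** * Segments of a diagram as edge sets of partitions *)

Section diagram_segments.
Variables (R : realType) (X Y : sds R) (alpha : sds_hom X Y).

Lemma tower_edges_id (P Q : towers X) :
  tower_edges (map (preimage (sds_id X))) P Q = kr_edges P Q.
Proof.
have -> : map (preimage (sds_id X)) = id by apply: funext; exact: map_id.
by [].
Qed.

Lemma subordinate_id (P Q : towers X) :
  refined_by P Q -> top Q `<=` top P -> subordinate (sds_id X) P Q.
Proof.
move=> PQ tPQ; split; last by rewrite top_kr_preimage.
move=> B /PQ[A PA BA]; exists A => //.
by apply/cells_kr_preimage; exists A.
Qed.

Lemma subordinate_level n m : n <= m ->
  subordinate (sds_id X) (sP X n) (sP X m).
Proof.
elim: m => [|m IH].
  by rewrite leqn0 => /eqP ->; apply: subordinate_id => // A; exists A.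
rewrite leq_eqVlt => /predU1P[->|/IH nm].
  by apply: subordinate_id => // A; exists A.
(* As a function, the composite of two identities is convertible to the identity. *)
apply: (subordinate_comp nm); apply: subordinate_id; first exact: s_refined.
exact: s_top_shrink.
Qed.

Lemma subordinate_trans P n m : subordinate alpha P (sP X n) -> n <= m ->
  subordinate alpha P (sP X m).
Proof. by move=> Pn /subordinate_level; exact: (subordinate_comp Pn). Qed.

(** Disjointness of the cells lets a tower of P occur in a tower of P only as the whole of itself,
    at position 0. *)
Lemma eid_kr_edges (P : towers X) : is_kr (sphi X) (sx0 X) P ->
  eid P =~ kr_edges P P.
Proof.
move=> krP; have H (S : P) : exists e : kr_edges P P,
    [/\ src _ e = S, rng _ e = S & (val e).2 = 0 :> nat].
  apply: tower_edges_mk; apply/andP; split; first by rewrite add0n.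
  by apply/asboolP => j _ x.
have [h hP] := choice H.
have hS e : exists S, h S = e.
  case: e => [[[S T] k] /= E]; exists S; have /andP[kT /asboolP ST] := E.
  have S0 := kr_size krP (valP S).
  have kT' : k < size (val T).
    by rewrite (leq_trans _ kT) // -{1}(addn0 (val k)) ltn_add2l.
  have [x Tx] := kr_nonempty krP (kr_cell_nth (valP T) kT').
  have [|TS k0] := kr_disjoint krP (valP T) (valP S) kT' S0.
    by exists x; split => //; apply: ST => //; rewrite addn0.
  apply: val_inj; case: (hP S); case: (h S) => [[[S' T'] k'] E'] /= -> -> k'0.
  by congr (_, _, _); apply: val_inj; rewrite //= k'0 k0.
have [g gK] := choice hS.
have hs S : src _ (h S) = S by have [] := hP S.
exists h; split => //=; [|by move=> S; have [] := hP S|].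
  by exists g => // S; rewrite -[LHS]hs gK hs.
move=> S T; have [_ /= -> ->] := hP S; have [_ /= -> ->] := hP T.
by rewrite leqnn andbT.
Qed.

Lemma seg_kr_edges n m : n <= m ->
  seg (Pobj X) n m =~ kr_edges (sP X n) (sP X m).
Proof.
have base k : seg (Pobj X) k k =~ kr_edges (sP X k) (sP X k).
  by rewrite segnn; apply: eid_kr_edges; exact: s_kr.
elim: m => [|m IH]; first by rewrite leqn0 => /eqP ->; exact: base.
rewrite leq_eqVlt ltnS => /predU1P[->|nm]; first exact: base.
rewrite segS //; apply: eiso_trans (ecomp_cong (IH nm) (eiso_refl _)) _.
have i := sub_edges_comp (s_kr X n) (s_kr X m) (s_kr X m.+1)
  (subordinate_level nm) (subordinate_level (leqnSn m)).
rewrite !tower_edges_id in i.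
exact: i.
Qed.

End diagram_segments.

(** * The premorphism of a sequence of admissible levels *)

Section Pmor_theory.
Variables (R : realType) (X Y : sds R) (alpha : sds_hom X Y).

Let F n k := tower_edges (map (preimage alpha)) (sP Y n) (sP X k).

Lemma sub_edges_seg n k l : subordinate alpha (sP Y n) (sP X k) -> k <= l ->
  F n k \oE seg (Pobj X) k l =~ F n l.
Proof.
move=> nk kl.
apply: eiso_trans (ecomp_cong (eiso_refl _) (seg_kr_edges X kl)) _.
rewrite -tower_edges_id.
apply: (sub_edges_comp (s_kr Y n) (s_kr X k) (s_kr X l) nk).
exact: subordinate_level.
Qed.

Lemma seg_sub_edges n m l : n <= m -> subordinate alpha (sP Y m) (sP X l) ->
  seg (Pobj Y) n m \oE F m l =~ F n l.
Proof.
move=> nm ml.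
apply: eiso_trans (ecomp_cong (seg_kr_edges Y nm) (eiso_refl _)) _.
rewrite -tower_edges_id.
apply: (sub_edges_comp (s_kr Y n) (s_kr Y m) (s_kr X l) _ ml).
exact: subordinate_level.
Qed.

Lemma adm_subordinate s n : admissible alpha s ->
  subordinate alpha (sP Y n) (sP X (s n)).
Proof. by move=> ad; split; [exact: adm_refined|exact: adm_top]. Qed.

Lemma sP0_tower (Z : sds R) (T : sP Z 0) : val T = [:: setT].
Proof.
have H S : S \in sP Z 0 -> S = [:: setT] by rewrite s_P0 inE => /eqP.
exact/H/valP.
Qed.

Lemma Pmor_premP s : admissible alpha s -> is_premorphism (Pmor_data alpha s).
Proof.
move=> ad; have sub n := adm_subordinate n ad.
have src_ex n (v : sP Y n) := sub_edges_src (s_kr Y n) (s_kr X (s n)) (sub n) v.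
have card_gt0 n : 0 < #|F n (s n)|.
  have /card_gt0P[v _] := Pobj_V_gt0 Y n; have [e _] := src_ex n v.
  by apply/card_gt0P; exists e.
split => //=.
- exact: adm0 ad.
- exact: adm_homo ad.
- exact: adm_unbounded ad.
- apply/eqP; rewrite eqn_leq card_gt0 andbT; apply/card_le1_eqP => e e' _ _.
  rewrite /F (adm0 ad) in e e' *.
  case: e e' => [[[S T] k] /= E] [[[S' T'] k'] /= E']; apply: val_inj => /=.
  (* At level 0 both towers consist of one cell, so k + 1 <= 1 and the edge is unique. *)
  move: E E'; rewrite /tower_edge !size_map !sP0_tower !addn1 !ltnS !leqn0.
  move=> /andP[/eqP k0 _] /andP[/eqP k'0 _].
  by congr (_, _, _); apply: val_inj; rewrite /= ?sP0_tower ?k0 ?k'0.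
- by move=> n w; exact: (sub_edges_rng (s_kr Y n) (s_kr X (s n)) (sub n) w).
- by move=> n; exact: (sub_edges_ord _ (s_kr Y n) (s_kr X (s n))).
(* Both sides are isomorphic to [F n (s n.+1)]. The segment from n to n+1 carries an identity edge
   set in front, which [ecomp1e] removes. *)
- move=> n; have := seg_sub_edges (leqnSn n) (sub n.+1).
  rewrite segS // segnn => j.
  apply: eiso_trans (eiso_sym (sub_edges_seg (sub n) (adm_homo ad n))).
  apply: eiso_trans j; apply: ecomp_cong (eiso_refl _).
  by apply: eiso_sym; apply: ecomp1e; exact: (b_ord (Pobj Y) n).
Qed.

Definition Pmor s (ad : admissible alpha s) : premorphism (Pobj Y) (Pobj X) :=
  Premorphism (Pmor_premP ad).

(** Both composites are isomorphic to [F n (t m)] once n <= m and s n <= t m; [m0] secures the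
    second bound. *)
Lemma Pmor_half s t (ads : admissible alpha s) (adt : admissible alpha t) :
  prem_half (Pmor ads) (Pmor adt).
Proof.
move=> n; have [m0 m0P] := lvl_large (Pmor adt) (s n).
exists (maxn n m0) => m; rewrite geq_max => /andP[nm /m0P /= stm].
split => //=; apply: eiso_trans (seg_sub_edges nm (adm_subordinate m adt)) _.
exact/eiso_sym/(sub_edges_seg (adm_subordinate n ads) stm).
Qed.

Lemma Pmor_indep s t (ads : admissible alpha s) (adt : admissible alpha t) :
  pclass (Pmor ads) = pclass (Pmor adt).
Proof. by apply/pclassP/prem_equivP; split; exact: Pmor_half. Qed.

End Pmor_theory.

(** * Existence of admissible levels *)

(** If no U n were everything, the complements would generate a proper filter. A cluster point of it
    would lie in some open U n, which misses its own complement. *)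
Lemma compact_increasing_cover (X : topologicalType) (U : nat -> set X) :
  compact [set: X] -> (forall n, open (U n)) ->
  (forall n m, n <= m -> U n `<=` U m) -> (forall x, exists n, U n x) ->
  exists n, forall x, U n x.
Proof.
move=> cX oU incr cov; apply: contrapT => noU.
pose F : set_system X := filter_from setT (fun n => ~` U n).
have FF : Filter F.
  apply: filter_fromT_filter; first by exists 0.
  move=> i j; exists (maxn i j) => x Ux; split => Ux'; apply: Ux.
    by apply: incr Ux'; exact: leq_maxl.
  by apply: incr Ux'; exact: leq_maxr.
have PF : ProperFilter F.
  apply: filter_from_proper => n _; apply: contrapT => nx; apply: noU.
  by exists n => x; apply: contrapT => Ux; apply: nx; exists x.
have [x [_ clx]] := cX F PF (@filterT _ _ FF).
have [n Ux] := cov x.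
have [y [Uy]] : (~` U n) `&` U n !=set0.
  by apply: clx; [exists n|exact: open_nbhs_nbhs].
exact.
Qed.

Section existence.
Variables (R : realType) (X Y : sds R) (alpha : sds_hom X Y).

Lemma top_clopen (P : towers X) : is_kr (sphi X) (sx0 X) P -> clopen (top P).
Proof.
move=> krP; have -> : top P = \bigcup_(S in [set` P]) last set0 S.
  by apply/seteqP; split => x [S SP Sx]; exists S.
have cS (S : seq (set X)) : S \in P -> clopen (last set0 S).
  move=> SP; apply: (kr_clopen krP); rewrite -nth_last.
  by apply: kr_cell_nth => //; rewrite prednK // (kr_size krP SP).
split; first by apply: bigcup_open => S /cS[].
by apply: closed_bigcup => // S /cS[].
Qed.

(** [D m] collects the cells of the m-th partition that fit into a cell of P. Their unions increase
    with m and cover X by the basis property. Once one union is everything, each cell at that level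
    meets, hence equals, a member of [D m]. *)
Lemma ex_refined (P : towers X) : is_kr (sphi X) (sx0 X) P ->
  exists m, refined_by P (sP X m).
Proof.
move=> krP; pose D m := [set B | cells (sP X m) B /\
  exists2 A, cells P A & B `<=` A].
have [||||m mP] := @compact_increasing_cover X (fun m => \bigcup_(B in D m) B).
- exact: s_compact.
- by move=> m; apply: bigcup_open => B [mB _]; case: (kr_clopen (s_kr X m) mB).
- move=> n m nm x [B [nB [A PA BA]] Bx]; have [C mC Cx] := ex_cell (s_kr X m) x.
  have [_ /cells_kr_preimage[B' nB' ->] CB'] := (subordinate_level X nm).1 _ mC.
  have BB' : B = B' by apply: (cell_inter (s_kr X n) nB nB' Bx); exact: CB'.
  exists C => //; split => //; exists A => // y /CB' /= B'y.
  by apply: BA; rewrite BB'.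
- move=> x; have [A PA Ax] := ex_cell krP x.
  have nA : nbhs x A.
    by apply: open_nbhs_nbhs; split => //; case: (kr_clopen krP PA).
  have [B [[n nB] Bx] BA] := (s_basis X).2 x A nA.
  by exists n, B => //; split => //; exists A.
exists m => C mC; have [x Cx] := kr_nonempty (s_kr X m) mC.
have [B [mB [A PA BA]] Bx] := mP x; exists A => //.
by rewrite (cell_inter (s_kr X m) mC mB Cx Bx).
Qed.

(** A point outside all the sets of the cover would lie in every top, hence be the base point, which
    belongs to the top of P. *)
Lemma ex_top (P : towers X) : is_kr (sphi X) (sx0 X) P ->
  exists m, top (sP X m) `<=` top P.
Proof.
move=> krP.
have [||||m mP] := @compact_increasing_cover X
    (fun m => ~` top (sP X m) `|` top P).
- exact: s_compact.
- move=> m; apply: openU; last by case: (top_clopen krP).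
  by apply: closed_openC; case: (top_clopen (s_kr X m)).
- move=> n m nm x [nx|]; [left|by right] => mx; apply: nx.
  by have := (subordinate_level X nm).2 x mx; rewrite top_kr_preimage.
- move=> x; apply: contrapT => nx.
  have xx0 : [set sx0 X] x.
    rewrite -s_tops_cap => n _; apply: contrapT => nPx.
    by apply: nx; exists n; left.
  by apply: nx; exists 0; right; rewrite xx0; exact: kr_top krP.
by exists m => x mx; case: (mP x).
Qed.

Lemma ex_subordinate n : exists m, subordinate alpha (sP Y n) (sP X m).
Proof.
have krP := kr_preimageP alpha (s_kr Y n).
have [k kP] := ex_refined krP; have [l lP] := ex_top krP.
exists (k + l); split.
  move=> B B'; have [_ /cells_kr_preimage[C kC ->] BC] :=
    (subordinate_level X (leq_addr l k)).1 _ B'.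
  by have [A A' CA] := kP _ kC; exists A => // x /BC /CA.
move=> x /(subordinate_level X (leq_addl k l)).2; rewrite top_kr_preimage.
exact: lP.
Qed.

Lemma ex_admissible : exists s, admissible alpha s.
Proof.
have [N NP] := choice ex_subordinate.
(* Partial sums are monotone and dominate each N n with n > 0; the extra successor in each term
   gives n <= s n, and the empty sum gives s 0 = 0. *)
pose s n := \sum_(i < n) (N i.+1).+1.
have s_ge n : n <= s n.
  by rewrite /s -{1}(card_ord n) -sum1_card leq_sum.
have sP n : subordinate alpha (sP Y n) (sP X (s n)).
  case: n => [|n].
    (* The inverse image of the trivial partition is trivial, so level 0 imposes no bound on s 0. *)
    split=> [B _|x _].
      exists [set: X] => //; apply/cells_kr_preimage; exists setT => //.
      by rewrite s_P0; exists [:: setT]; rewrite ?inE.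
    by rewrite top_kr_preimage s_P0; exists [:: setT]; rewrite ?inE.
  apply: subordinate_trans (NP n.+1) _.
  by rewrite /s big_ord_recr /= (leq_trans (leqnSn _)) // leq_addl.
exists s; split; first by rewrite /s big_ord0.
- by move=> n; rewrite /s big_ord_recr leq_addr.
- by move=> n; exists n.
- by move=> n; case: (sP n).
- by move=> n; case: (sP n).
Qed.

End existence.

(** * Functoriality *)

(** By independence of the levels one may take s n = n, where every edge set is an identity edge set
    by [eid_kr_edges]. *)
Lemma Pmor_id (R : realType) (X : sds R) s (ad : admissible (sds_id X) s) :
  pclass (Pmor ad) = pclass (pid (Pobj X)).
Proof.
have adi : admissible (sds_id X) id.
  split => //; first by move=> N; exists N.
    by move=> n; case: (subordinate_level X (leqnn n)).
  by move=> n; case: (subordinate_level X (leqnn n)).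
rewrite (Pmor_indep ad adi); apply/pclassP/prem_equiv_iso => n /=.
exists erefl => /=; rewrite tower_edges_id; apply: eiso_sym.
exact/eid_kr_edges/s_kr.
Qed.

(** The levels [t \o s] are admissible for the composite, and at these levels the two premorphisms
    agree termwise by [sub_edges_comp]. *)
Lemma Pmor_comp (R : realType) (W X Y : sds R)
    (alpha : sds_hom X Y) (beta : sds_hom W X) s t u
    (ads : admissible alpha s) (adt : admissible beta t)
    (adu : admissible (sds_comp alpha beta) u) :
  pclass (Pmor adu) = pclass (Defs.pcomp (Pmor adt) (Pmor ads)).
Proof.
have sub n :=
  subordinate_comp (adm_subordinate n ads) (adm_subordinate (s n) adt).
have adc : admissible (sds_comp alpha beta) (t \o s).
  split => /=.
  - by rewrite (adm0 ads) (adm0 adt).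
  - move=> n; apply: (lvl_le (Pmor adt)); exact: adm_homo ads n.
  - exact: lvl_unbounded (premP (Defs.pcomp (Pmor adt) (Pmor ads))).
  - by move=> n; case: (sub n).
  - by move=> n; case: (sub n).
rewrite (Pmor_indep adu adc); apply/pclassP/prem_equiv_iso => n /=.
exists erefl => /=; apply: eiso_sym.
exact: (sub_edges_comp (s_kr Y n) (s_kr X (s n)) (s_kr W (t (s n)))
  (adm_subordinate n ads) (adm_subordinate (s n) adt)).
Qed.

Definition Pfun (R : realType) (X Y : sds R) (alpha : sds_hom X Y) :
    obd_hom (Pobj Y) (Pobj X) :=
  pclass (Pmor (projT2 (cid (ex_admissible alpha)))).

Theorem proposition3p7 (R : realType) :
  exists P1 : forall X Y : SDS R, cat_hom X Y ->
      @cat_hom OBD (Pobj Y) (Pobj X),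
    @contravariant_functor (SDS R) OBD (@Pobj R) P1 /\
    forall (X Y : SDS R) (alpha : cat_hom X Y),
      (exists s : nat -> nat, admissible alpha s) /\
      (forall s : nat -> nat, admissible alpha s ->
         exists fP : is_premorphism (Pmor_data alpha s),
           P1 X Y alpha = pclass (Premorphism fP)).
Proof.
exists (@Pfun R); split; first split.
- by move=> X; exact: Pmor_id.
- move=> X Y Z g f; rewrite /= /Pfun obd_compE; exact: Pmor_comp.
- move=> X Y alpha; split; first exact: ex_admissible.
  by move=> s ad; exists (Pmor_premP ad); exact: (Pmor_indep _ ad).
Qed.
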